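(* Let $s\in(0,1)$ and let $\Omega\subset\mathbb{R}^n$ be a bounded domain. If $(-\Delta)^s u\ge 0$ in $\Omega$ and $u\ge 0$ in $\mathbb{R}^n\setminus\Omega$, then $u\ge 0$ in $\Omega$. Moreover, $u>0$ in $\Omega$, unless $u\equiv 0$.
   Context: Here $u:\mathbb{R}^n\to\mathbb{R}$ is a function whose fractional Laplacian is defined in $\Omega$, where for $s\in(0,1)$ the fractional Laplacian is $$(-\Delta)^s u(x):=c_{n,s}\lim_{\varepsilon\to0^+}\int_{\mathbb{R}^n\setminus B_\varepsilon(x)}\frac{u(x)-u(y)}{|x-y|^{n+2s}}\,dy=\frac{c_{n,s}}{2}\int_{\mathbb{R}^n}\frac{2u(x)-u(x+y)-u(x-y)}{|y|^{n+2s}}\,dy,$$ with $B_\varepsilon(x)$ the ball of radius $\varepsilon$ centered at $x$, $c_{n,s}:=\left(\int_{\mathbb{R}^n}\frac{1-\cos\zeta_1}{|\zeta|^{n+2s}}\,d\zeta\right)^{-1}>0$, and $\zeta_1$ the first coordinate of $\zeta\in\mathbb{R}^n$. The operator is introduced for $u$ in the Schwartz space of rapidly decreasing smooth functions, but the formula also makes sense for $u\in C^2(\mathbb{R}^n)\cap L^\infty(\mathbb{R}^n)$, and, at a given point $x$, whenever $u\in L^1_{\rm loc}(\mathbb{R}^n)$ satisfies $\int_{\mathbb{R}^n}\frac{|u(y)|}{1+|y|^{n+2s}}\,dy<\infty$ and $u$ is of class $C^{2s+\varepsilon}$ in a neighborhood of $x$ for some small $\varepsilon>0$ (meaning $C^{0,2s+\varepsilon}$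 if $2s+\varepsilon\le1$ and $C^{1,2s+\varepsilon-1}$ if $1<2s+\varepsilon\le 2$). The theorem itself prescribes no particular regularity class for $u$.
   Formalization: u is also assumed lower semicontinuous on the closure of Ω (else u=-(1-|x|^2)_+^{s-1} in the unit ball is a counterexample), and ''u≡0'' is read as u=0 a.e. in R^n, everywhere in Ω and at every continuity point of u (an indicator of one exterior point defeats literal identity). *)

(* Defs.v *)
From HB Require Import structures.
From mathcomp Require Import all_boot all_order all_algebra.
From mathcomp Require Import all_classical all_reals all_analysis.

Set Implicit Arguments.
Unset Strict Implicit.
Unset Printing Implicit Defensive.

Import Order.TTheory GRing.Theory Num.Theory.
Import numFieldNormedType.Exports.

Local Open Scope classical_set_scope.
Local Open Scope ring_scope.

Section lebesgue_measure_rV.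
Context {R : realType}.
Notation T := (measurableTypeR R).

Definition tuple_cons n (p : T * n.-tuple T) : n.+1.-tuple T :=
  [tuple of p.1 :: p.2].

Lemma measurable_tuple_cons n : measurable_fun setT (@tuple_cons n).
Proof. exact: measurable_cons. Qed.

Definition lebesgue_cons n (mu : {measure set (n.-tuple T) -> \bar R}) :
    set (n.+1.-tuple T) -> \bar R :=
  pushforward (lebesgue_measure \x^ mu)%E (@tuple_cons n).

HB.instance Definition _ n mu := Measure.copy (@lebesgue_cons n mu)
  (measure_function_pushforward__canonical__measure_function_Measure
     (lebesgue_measure \x^ mu)%E (@measurable_tuple_cons n)).

Fixpoint lebesgue_tuple n : {measure set (n.-tuple T) -> \bar R} :=
  if n is m.+1 then lebesgue_cons (lebesgue_tuple m) else \d_ [tuple].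

Definition tuple_of_rV n (v : 'rV[R]_n) : n.-tuple T := [tuple v ord0 i | i < n].

Definition rV_of_tuple n (t : n.-tuple T) : 'rV[R]_n := \row_i tnth t i.

Lemma tuple_of_rVK n : cancel (@tuple_of_rV n) (@rV_of_tuple n).
Proof. by move=> v; apply/rowP => i; rewrite mxE tnth_mktuple. Qed.

Lemma rV_of_tupleK n : cancel (@rV_of_tuple n) (@tuple_of_rV n).
Proof. by move=> t; apply/eq_from_tnth => i; rewrite tnth_mktuple mxE. Qed.

(* 'rV[R]_n with the product of the Borel sigma-algebras of its coordinates *)
Definition borel_rV n : Type := g_sigma_algebra_preimageType (@tuple_of_rV n).
HB.instance Definition _ n := Measurable.on (borel_rV n).

Lemma measurable_rV_of_tuple n :
  measurable_fun setT (@rV_of_tuple n : n.-tuple T -> borel_rV n).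
Proof.
move=> _ _ [B mB <-]; rewrite !setTI -comp_preimage.
by rewrite (_ : _ \o _ = id) //; apply/funext => t /=; rewrite rV_of_tupleK.
Qed.

Definition borel_lebesgue n : set (borel_rV n) -> \bar R :=
  pushforward (lebesgue_tuple n) (@rV_of_tuple n : n.-tuple T -> borel_rV n).

HB.instance Definition _ n := Measure.copy (@borel_lebesgue n)
  (measure_function_pushforward__canonical__measure_function_Measure
     (lebesgue_tuple n) (@measurable_rV_of_tuple n)).

(* 'rV[R]_n with its Lebesgue measurable sets, i.e. the Caratheodory measurable
   sets of the outer measure of borel_lebesgue *)
Definition lebesgue_rV n : Type :=
  caratheodory_type (mu_ext (@borel_lebesgue n)).
HB.instance Definition _ n := Measurable.on (lebesgue_rV n).

Definition lebesgue n : {measure set (lebesgue_rV n) -> \bar R} :=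
  @completed_measure_extension _ _ _ (@borel_lebesgue n).

Lemma lebesgue_tuple_box n (A : 'I_n -> set T) :
  (forall i, measurable (A i)) ->
  measurable [set t : n.-tuple T | forall i, A i (tnth t i)] /\
  lebesgue_tuple n [set t | forall i, A i (tnth t i)] =
    (\prod_(i < n) lebesgue_measure (A i))%E.
Proof.
elim: n A => [|n IHn] A mA.
  rewrite big_ord0 (_ : [set t | _] = setT); last first.
    by apply/seteqP; split=> // t _ [].
  by split; [exact: measurableT|rewrite /= diracT].
have [mB lB] := IHn (fun i => A (lift ord0 i)) (fun i => mA _).
split.
  rewrite (_ : [set t | _] = \bigcap_(i in setT) (fun t => tnth t i) @^-1` A i).
    apply: fin_bigcap_measurable => // i _.
    by rewrite -[X in measurable X]setTI; exact: measurable_tnth.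
  by apply/seteqP; split=> [t /= tA i _|t /= tA i]; exact: tA.
rewrite big_ord_recl -lB /=.
rewrite -product_measure2E// /lebesgue_cons /pushforward.
congr (product_measure2 _ _ _).
have cons0 x (t : n.-tuple T) : tnth (tuple_cons (x, t)) ord0 = x.
  by rewrite (tnth_nth x).
have consS x (t : n.-tuple T) i :
    tnth (tuple_cons (x, t)) (lift ord0 i) = tnth t i.
  by rewrite (tnth_nth x) [RHS](tnth_nth x).
apply/seteqP; split=> [[x t] /= tA|[x t] /= [Ax At] i].
  split; first by rewrite -[x](cons0 x t).
  by move=> i; rewrite -(consS x t).
by case: (unliftP ord0 i) => [j|] ->; rewrite ?cons0 ?consS.
Qed.

Lemma lebesgue_box n (A : 'I_n -> set T) :
  (forall i, measurable (A i)) ->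
  measurable ([set v | forall i, A i (v ord0 i)] : set (lebesgue_rV n)) /\
  lebesgue n [set v | forall i, A i (v ord0 i)] =
    (\prod_(i < n) lebesgue_measure (A i))%E.
Proof.
move=> mA; have [mB lB] := lebesgue_tuple_box mA.
have mb : measurable ([set v | forall i, A i (v ord0 i)] : set (borel_rV n)).
  exists [set t | forall i, A i (tnth t i)] => //; rewrite setTI.
  by apply/seteqP; split=> v /= vA i; have := vA i; rewrite tnth_mktuple.
split; first exact: caratheodory_measurable_mu_ext.
rewrite /lebesgue /= /completed_measure_extension measurable_mu_extE//= -lB.
rewrite /borel_lebesgue /pushforward; congr (lebesgue_tuple n _).
by apply/seteqP; split=> v /= vA i; have := vA i; rewrite mxE.
Qed.

End lebesgue_measure_rV.
Arguments lebesgue {R} n.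

Section fractional_laplacian.
Context {R : realType} (n : nat).
(* the ambient space is R^(n + 1), so that a first coordinate exists *)
Notation V := 'rV[R]_n.+1.
Implicit Types (s e : R) (x y z : V) (u : V -> R).

(* The library norm on 'rV[R]_n is the sup norm; it is only used here through
   the topology and the bounded sets it defines, which are the Euclidean ones. *)
Definition enorm x : R := Num.sqrt (\sum_i x ord0 i ^+ 2).

Definition eball x e : set V := [set y | enorm (x - y) < e].

(* The totalised quotient is 0 at x = 0, a null set in all integrals below. *)
Definition frac_kernel s x : R := (enorm x `^ (n.+1%:R + 2 * s))^-1.

Definition frac_const s : R :=
  (\int[lebesgue n.+1]_z ((1 - cos ((z : V) ord0 ord0)) * frac_kernel s z))^-1.

Definition frac_integrand s u x y : R := (u x - u y) * frac_kernel s (x - y).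

Definition frac_truncated s u x e : R :=
  \int[lebesgue n.+1]_(y in ~` eball x e) frac_integrand s u x y.

Definition frac_laplacian s u x : R :=
  frac_const s * lim (frac_truncated s u x e @[e --> 0^'+]).

(* A pointwise principal value: truncated integrals converge absolutely and have
   a finite limit. This needs no regularity class for u. *)
Definition frac_laplacian_defined s u x : Prop :=
  (forall e, 0 < e -> (lebesgue n.+1).-integrable (~` eball x e)
                        (EFin \o frac_integrand s u x)) /\
  cvg (frac_truncated s u x e @[e --> 0^'+]).

Definition bounded_domain (Omega : set V) : Prop :=
  [/\ open Omega, connected Omega, Omega !=set0 & bounded_set Omega].

(* Semicontinuity up to the boundary cannot be dropped from the maximum
   principle: u x = - (1 - |x|^2)_+ `^ (s - 1) is s-harmonic in the unit ball,
   vanishes outside of it and is negative inside. *)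
Definition lsc_within (A : set V) u : Prop :=
  lower_semicontinuous (fun x : subspace A => (u x)%:E).

End fractional_laplacian.

(* Main.v *)
(* On the compact closure of Omega the lower semicontinuous u attains its minimum
   at some m. If u m < 0, then m lies in Omega and minimises u globally, so the
   integrand (u m - u y) K(m - y) is nonpositive: the truncated integrals decrease
   as the radius tends to 0, are at most 0, and have a nonnegative limit, hence
   all vanish. Thus u = u m almost everywhere, against u >= 0 outside of the
   bounded set Omega. A zero of u in Omega is a global minimum in the same way
   and forces u = 0 almost everywhere; lower semicontinuity upgrades this to every
   point of Omega. The sign of the limit can be read off only because c_{n,s} > 0,
   i.e. because (1 - cos z_1) |z|^{-n-2s} is integrable: it is compared with
   constants on dyadic cubes, which yields two geometric series. *)

Require Import Defs.
From mathcomp Require Import all_boot all_order all_algebra.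
From mathcomp Require Import all_classical all_reals all_analysis.
From mathcomp Require Import measurable_realfun ring lra.
Import Order.TTheory GRing.Theory Num.Theory.
Import numFieldNormedType.Exports.
Local Open Scope classical_set_scope.
Local Open Scope ring_scope.

(** * Measurability in coordinates, cubes and null sets *)

Section lebesgue_rV_theory.
Context {R : realType}.

Lemma measurable_coord n (i : 'I_n) :
  measurable_fun [set: lebesgue_rV n]
    (fun v : lebesgue_rV n => (v : 'rV[R]_n) ord0 i).
Proof.
move=> _ B mB; rewrite setTI.
pose A j := if j == i then B else setT.
have mA j : measurable (A j) by rewrite /A; case: ifP.
have [mbox _] := lebesgue_box mA; congr (measurable _): mbox.
apply/seteqP; split=> v /=.
  by move=> /(_ i); rewrite /A eqxx.
by move=> Bv j; rewrite /A; case: eqP => // ->.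
Qed.

Lemma measurable_enormB n (x : 'rV[R]_n.+1) :
  measurable_fun [set: lebesgue_rV n.+1]
    (fun y : lebesgue_rV n.+1 => enorm (x - y)).
Proof.
rewrite /enorm.
have sum_ge0 (y : 'rV[R]_n.+1) : 0 <= \sum_i (x - y) ord0 i ^+ 2.
  by apply: sumr_ge0 => i _; exact: sqr_ge0.
(* The square root is turned into the power 1/2 so that [measurable_powR] applies; the inverse in
   the kernel becomes the power -1 for the same reason. *)
under eq_fun do rewrite -powR12_sqrt//.
apply: (measurableT_comp (measurable_powR _)).
apply: measurable_sum => i; apply: measurable_funX.
under eq_fun do rewrite !mxE.
apply: measurable_funB; first exact: measurable_cst.
exact: measurable_coord.
Qed.

Lemma measurable_frac_kernelB n (s : R) (x : 'rV[R]_n.+1) :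
  measurable_fun [set: lebesgue_rV n.+1]
    (fun y : lebesgue_rV n.+1 => frac_kernel s (x - y)).
Proof.
rewrite /frac_kernel.
under eq_fun do rewrite -powR_inv1 ?powR_ge0//.
apply: (measurableT_comp (measurable_powR _)).
apply: (measurableT_comp (measurable_powR _)).
exact: measurable_enormB.
Qed.

Lemma measurable_eball n (x : 'rV[R]_n.+1) e :
  measurable (eball x e : set (lebesgue_rV n.+1)).
Proof.
rewrite /eball -[X in measurable X]setTI.
rewrite (_ : [set y | _] =
    (fun y : lebesgue_rV n.+1 => enorm (x - y)) @^-1` `]-oo, e[); last first.
  by apply/seteqP; split=> y /=; rewrite in_itv.
exact: measurable_enormB.
Qed.

(** As products of intervals, cubes are measured directly by [lebesgue_box]; they replace Euclidean
    balls wherever a volume is needed. *)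
Definition cube {n} (x : 'rV[R]_n) (r : R) : set 'rV[R]_n :=
  [set y | forall i, y ord0 i \in `[x ord0 i - r, x ord0 i + r]].

Lemma cube_measure {n} (x : 'rV[R]_n) r : 0 <= r ->
  measurable (cube x r : set (lebesgue_rV n)) /\
  lebesgue n (cube x r) = ((2 * r) ^+ n)%:E.
Proof.
move=> r0.
have mA i : measurable (`[x ord0 i - r, x ord0 i + r] : set (measurableTypeR R)).
  exact: measurable_itv.
have [mb ->] := lebesgue_box mA; split=> //.
rewrite (eq_bigr (fun=> (2 * r)%:E)) => [|i _].
  by rewrite prodEFin prodr_const card_ord.
rewrite lebesgue_measure_itv/= lte_fin.
case: ifPn => [_|]; first by rewrite -EFinB; congr EFin; ring.
rewrite -leNgt => h; congr EFin; suff: r = 0 by move=> ->; rewrite mulr0.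
lra.
Qed.

Lemma nbhs_cube {n} (x : 'rV[R]_n) (A : set 'rV[R]_n) : nbhs x A ->
  exists2 r : R, 0 < r & cube x r `<=` A.
Proof.
move=> /nbhs_ballP[e /= e0 xeA]; exists (e / 2); first by rewrite divr_gt0.
move=> y xy; apply: xeA; split=> // i j.
rewrite ord1 /ball/= ltr_norml; have /= := xy j.
by rewrite in_itv/= => /andP[? ?]; apply/andP; split; lra.
Qed.

(** A neighbourhood contains a cube with r > 0, and (2r)^n is nonzero. *)
Lemma nbhs_not_negligible {n} (x : 'rV[R]_n) (A : set 'rV[R]_n) : nbhs x A ->
  ~ (lebesgue n).-negligible (A : set (lebesgue_rV n)).
Proof.
move=> /nbhs_cube[r r0 rA].
move/(@negligibleS _ (lebesgue_rV n) _ (lebesgue n) _ _ rA).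
have [mc lc] := cube_measure x _ (ltW r0).
move/(negligibleP _ mc).
change (@lebesgue R n (cube x r) = 0 -> False); rewrite lc => -[] /eqP.
by rewrite expf_eq0/= mulf_eq0 pnatr_eq0/= gt_eqF// andbF.
Qed.

(** Turns almost everywhere vanishing into vanishing at a point, as soon as positivity at that point
    would spread to a neighbourhood. *)
Lemma ae0_nbhs {n} (u : 'rV[R]_n -> R) (x : 'rV[R]_n) :
  {ae lebesgue n, forall y, u y = 0} -> ~ (\forall y \near x, 0 < u y).
Proof.
move=> u0 /nbhs_not_negligible; apply; apply: negligibleS u0 => y /= uy u0y.
by rewrite u0y ltxx in uy.
Qed.

End lebesgue_rV_theory.

(** * Elementary bounds, dyadic scales and integrability by covering *)

Section dyadic_estimates.
Context {R : realType}.

Lemma exp_powR (a s : R) k : 0 <= a -> (a ^+ k) `^ s = (a `^ s) ^+ k.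
Proof.
move=> a0; rewrite -(powR_mulrn k a0) -(powR_mulrn k (powR_ge0 _ _)).
by rewrite -!powRrM (mulrC s).
Qed.

(** The mean value theorem is used twice: sin c <= c for c > 0, then 1 - cos x = x sin c with 0 < c
    < x. Evenness reduces to x > 0. *)
Lemma ler_1Bcos (x : R) : 1 - cos x <= x ^+ 2.
Proof.
wlog x0 : x / 0 < x => [hw|].
  have [/hw//|x0|<-] := ltgtP 0 x; last by rewrite cos0 subrr expr0n.
  by rewrite -cosN -sqrrN hw// oppr_gt0.
have sin_le (c : R) : 0 < c -> sin c <= c.
  move=> c0; have [|d _] := @MVT R sin cos 0 c c0.
    by apply: continuous_subspaceT => z; exact: continuous_sin.
  by rewrite sin0 !subr0 => ->; rewrite ler_piMl ?cos_le1// ltW.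
have [|c] := @MVT R cos (fun z => - sin z) 0 x x0.
  by apply: continuous_subspaceT => z; exact: continuous_cos.
rewrite in_itv/= => /andP[c0 cx]; rewrite cos0 subr0 => E.
have -> : 1 - cos x = sin c * x by rewrite -[LHS]opprB E mulNr opprK.
by rewrite expr2 ler_pM2r// (le_trans (sin_le _ c0))// ltW.
Qed.

Lemma dyadic_scale (t : R) : 0 < t <= 1 ->
  exists k, 2^-1 ^+ k.+1 < t <= 2^-1 ^+ k.
Proof.
move=> /andP[t0 t1]; have ex : exists k, (2^-1 ^+ k.+1 : R) < t.
  (* With m the truncation of 1/t, one has 1/t < m + 1 <= 2^(m+1). The least such exponent then
     gives the upper bound on t. *)
  exists (Num.truncn t^-1).
  rewrite exprVn invf_plt ?posrE ?exprn_gt0//.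
  have /(lt_le_trans (truncnS_gt _)) -> // :
      ((Num.truncn t^-1).+1%:R : R) <= 2 ^+ (Num.truncn t^-1).+1.
  by rewrite -natrX ler_nat ltnW// ltn_expl.
have [k kt kmin] := ex_minnP ex; exists k; rewrite kt/=.
case: k kmin {kt} => [|k] kmin; first by rewrite expr0.
by rewrite leNgt; apply/negP => /kmin; rewrite ltnn.
Qed.

(** On D, f is dominated by the sum of the [c k] times the indicators of [F k]; integrating termwise
    leaves a geometric series. The [F k] may overlap, so whole cubes can stand in for dyadic
    shells. *)
Lemma integral_cover_lty d (T : measurableType d) (mu : {measure set T -> \bar R})
    (D : set T) (f : T -> \bar R) (F : nat -> set T) (c : nat -> R) (C w : R) :
  measurable D -> measurable_fun D f -> (forall x, D x -> 0 <= f x)%E ->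
  (forall k, measurable (F k)) -> (forall k, 0 <= c k) ->
  (forall x, D x -> exists2 k, F k x & f x <= (c k)%:E)%E ->
  (forall k, (c k)%:E * mu (F k) <= (C * w ^+ k)%:E)%E ->
  0 <= C -> 0 <= w < 1 ->
  (\int[mu]_(x in D) f x < +oo)%E.
Proof.
move=> mD mf f0 mF c0 fF cF C0 /andP[w0 w1].
pose g k x : \bar R := (c k * \1_(F k) x)%:E.
have g0 k x : (0 <= g k x)%E by rewrite lee_fin mulr_ge0.
have mg k : measurable_fun setT (g k).
  apply/measurable_EFinP; apply: measurable_funM; first exact: measurable_cst.
  exact: measurable_indic.
have le1 : (\int[mu]_(x in D) f x <= \int[mu]_(x in D) \sum_(0 <= k <oo) g k x)%E.
  apply: ge0_le_integral => //.
  - apply: (@ge0_emeasurable_sum _ _ _ _ _ xpredT) => //.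
    by move=> k _; exact: measurable_funTS.
  - move=> x /fF[k Fkx /le_trans]; apply.
    have -> : (c k)%:E = g k x by rewrite /g indicE mem_set// mulr1.
    rewrite (@nneseries_split _ _ 0 k.+1)// add0n big_nat_recr//=.
    rewrite -addeA addeC -addeA leeDl// adde_ge0//.
      by apply: nneseries_ge0.
    by apply: sume_ge0.
apply: le_lt_trans le1 _.
rewrite integral_nneseries//; last by move=> k; exact: measurable_funTS.
have le2 k : (\int[mu]_(x in D) g k x <= (C * w ^+ k)%:E)%E.
  apply: le_trans (cF k).
  apply: (@le_trans _ _ (\int[mu]_x g k x)%E); first exact: ge0_subset_integral.
  rewrite /g; under eq_integral do rewrite EFinM.
  rewrite ge0_integralZl//; last 2 first.
  - by apply/measurable_EFinP; exact: measurable_indic.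
  - by rewrite lee_fin.
  by rewrite integral_indic// setIT.
apply: le_lt_trans (lee_nneseries _ (fun k _ => le2 k)) _.
  by move=> k _ _; exact: integral_ge0.
apply: (@le_lt_trans _ _ (C / (1 - w))%:E); last exact: ltry.
apply: lime_le.
  by apply: is_cvg_nneseries => k _ _; rewrite lee_fin mulr_ge0// exprn_ge0.
apply: nearW => m; rewrite sumEFin lee_fin.
have := geometric_seriesE C (negbT (lt_eqF w1)) => /(congr1 (fun h => h m)).
rewrite /series/= => ->; rewrite ler_pM2r ?invr_gt0 ?subr_gt0//.
by rewrite ler_piMr// gerBl exprn_ge0.
Qed.

Lemma enorm_ge0 n (z : 'rV[R]_n.+1) : 0 <= enorm z.
Proof. exact: sqrtr_ge0. Qed.

Lemma ler_coord_enorm n (z : 'rV[R]_n.+1) i : `|z ord0 i| <= enorm z.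
Proof.
rewrite -sqrtr_sqr ler_wsqrtr// (bigD1 i)//= lerDl sumr_ge0// => j _.
exact: sqr_ge0.
Qed.

Lemma enorm_eq0 n (z : 'rV[R]_n.+1) : enorm z = 0 -> z = 0.
Proof.
move=> z0; apply/rowP => i; rewrite mxE; apply/eqP; rewrite -normr_eq0.
by rewrite eq_le normr_ge0 andbT -z0 ler_coord_enorm.
Qed.

Lemma enorm_cube n (z : 'rV[R]_n.+1) r : enorm z <= r -> cube 0 r z.
Proof.
move=> zr i; rewrite in_itv/= mxE sub0r add0r -ler_norml.
by rewrite (le_trans (ler_coord_enorm _ _ _)).
Qed.

Lemma frac_kernel_ge0 n s (z : 'rV[R]_n.+1) : 0 <= frac_kernel s z.
Proof. by rewrite invr_ge0 powR_ge0. Qed.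

Lemma frac_kernel_gt0 n s (z : 'rV[R]_n.+1) : 0 < enorm z -> 0 < frac_kernel s z.
Proof. by move=> z0; rewrite invr_gt0 powR_gt0. Qed.

(** The power t^(n+1+2s) is split so that t^(n+1) cancels against the volume of a cube of side
    proportional to t. *)
Lemma frac_kernel_le n s t (z : 'rV[R]_n.+1) : 0 < s -> 0 < t <= enorm z ->
  frac_kernel s z <= (t ^+ n.+1 * (t `^ s) ^+ 2)^-1.
Proof.
move=> s0 /andP[t0 tz].
have -> : t ^+ n.+1 * (t `^ s) ^+ 2 = t `^ (n.+1%:R + 2 * s).
  rewrite powRD ?(gt_eqF t0) ?implybT// powR_mulrn 1?ltW//; congr (_ * _).
  by rewrite mulrC powRrM -powR_mulrn// powR_ge0.
rewrite lef_pV2 ?posrE ?powR_gt0 ?(lt_le_trans t0)//.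
by rewrite ge0_ler_powR ?nnegrE ?enorm_ge0 ?(ltW t0)// addr_ge0// mulr_ge0// ltW.
Qed.

End dyadic_estimates.

(** * Finiteness and positivity of the constant c_{n,s} *)

Section frac_const_finite.
Context {R : realType} (n : nat).
Notation V := 'rV[R]_n.+1.

Lemma powR_lt1 (a r : R) : 0 <= a < 1 -> 0 < r -> a `^ r < 1.
Proof.
move=> /andP[a0 a1] r0; have := gt0_ltr_powR r0 _ _ a1.
by rewrite powR1 !nnegrE; apply.
Qed.

Lemma powR_gt1 (a r : R) : 1 < a -> 0 < r -> 1 < a `^ r.
Proof.
move=> a1 r0; have := gt0_ltr_powR r0 _ _ a1.
by rewrite powR1 !nnegrE; apply=> //; rewrite ltW// (lt_trans _ a1).
Qed.

Lemma enormN (z : V) : enorm (- z) = enorm z.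
Proof. by congr Num.sqrt; apply: eq_bigr => i _; rewrite mxE sqrrN. Qed.

Definition frac_const_integrand (s : R) (z : V) : R :=
  (1 - cos (z ord0 ord0)) * frac_kernel s z.

Lemma frac_const_integrand_ge0 s z : 0 <= frac_const_integrand s z.
Proof. by rewrite mulr_ge0 ?frac_kernel_ge0// subr_ge0 cos_le1. Qed.

Lemma measurable_frac_const_integrand s :
  measurable_fun [set: lebesgue_rV n.+1]
    (frac_const_integrand s : lebesgue_rV n.+1 -> R).
Proof.
apply: measurable_funM.
  apply: measurable_funB; first exact: measurable_cst.
  apply: (measurableT_comp (continuous_measurable_fun (@continuous_cos R))).
  exact: measurable_coord.
have := measurable_frac_kernelB n s 0; congr (measurable_fun _ _).
by apply/funext => z; rewrite /frac_kernel sub0r enormN.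
Qed.

Lemma frac_const_integrand_near0 s t z : 0 < s -> 0 < t <= enorm z ->
  enorm z <= 2 * t ->
  frac_const_integrand s z <= (2 * t) ^+ 2 * (t ^+ n.+1 * (t `^ s) ^+ 2)^-1.
Proof.
move=> s0 tz z2t; rewrite ler_pM ?subr_ge0 ?cos_le1 ?frac_kernel_ge0
  ?frac_kernel_le//.
rewrite (le_trans (ler_1Bcos _))// -real_normK ?num_real//.
rewrite lerXn2r ?nnegrE// ?(le_trans (ler_coord_enorm _ _ _))//.
by rewrite (le_trans (enorm_ge0 _ z)).
Qed.

Lemma frac_const_integrand_far s t z : 0 < s -> 0 < t <= enorm z ->
  frac_const_integrand s z <= 2 * (t ^+ n.+1 * (t `^ s) ^+ 2)^-1.
Proof.
move=> s0 tz; rewrite ler_pM ?subr_ge0 ?cos_le1 ?frac_kernel_ge0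
  ?frac_kernel_le//.
by have := cos_geN1 (z ord0 ord0); lra.
Qed.

(** With t = 2^-(k+1), the shell t < |z| <= 2t lies in a cube of volume (4t)^(n+1), and the bound on
    it contributes 4 * 4^(n+1) * t^(2-2s). The ratio w = 2^-(2-2s) is below 1 because s < 1; the
    extra factor w in the constant comes from the exponent k+1. *)
Lemma frac_const_integral_near0_lty s : 0 < s -> s < 1 ->
  (\int[lebesgue n.+1]_(z in (eball (0%R : V) 1%R : set (lebesgue_rV n.+1)))
     (frac_const_integrand s z)%:E < +oo)%E.
Proof.
move=> s0 s1; pose q : R := 2^-1; pose t k := q ^+ k.+1.
have q0 : 0 < q by rewrite invr_gt0.
have t0 k : 0 < t k by exact: exprn_gt0.
have r0 k : 0 <= 2 * t k by rewrite mulr_ge0// ltW.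
pose c k := (2 * t k) ^+ 2 * (t k ^+ n.+1 * (t k `^ s) ^+ 2)^-1.
pose w := (q / (q `^ s)) ^+ 2.
have mB : measurable (eball (0 : V) 1 : set (lebesgue_rV n.+1)).
  exact: measurable_eball.
apply: (@integral_cover_lty R _ (lebesgue_rV n.+1) (lebesgue n.+1) _ _
  (fun k => cube (0 : V) (2 * t k)) c (4 * 4 ^+ n.+1 * w) w).
- exact: mB.
- apply/measurable_EFinP; apply: measurable_funTS.
  exact: measurable_frac_const_integrand.
- by move=> z _; rewrite lee_fin frac_const_integrand_ge0.
- by move=> k; have [] := cube_measure (0 : V) (2 * t k) (r0 k).
- by move=> k; rewrite mulr_ge0 ?sqr_ge0// invr_ge0 mulr_ge0 ?sqr_ge0// exprn_ge0// ltW.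
- move=> z; rewrite /eball/= sub0r enormN => z1.
  (* The origin lies in no shell, but the integrand vanishes there and any cube will do. *)
  have [z0|z0] := eqVneq (enorm z) 0.
    exists 0%N; first by apply: enorm_cube; rewrite z0.
    rewrite lee_fin /frac_const_integrand (enorm_eq0 _ _ z0) mxE cos0 subrr mul0r.
    by rewrite mulr_ge0 ?sqr_ge0// invr_ge0 mulr_ge0 ?sqr_ge0// exprn_ge0// ltW.
  have [|k /andP[tz zt]] := @dyadic_scale R (enorm z).
    by rewrite lt_neqAle eq_sym z0 enorm_ge0 ltW.
  have E : 2 * t k = q ^+ k by rewrite /t exprS mulrA mulfV ?mul1r.
  exists k; first by apply: enorm_cube; rewrite E.
  rewrite lee_fin; apply: frac_const_integrand_near0 => //; last by rewrite E.
  by rewrite t0 ltW.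
- move=> k; have [_ ->] := cube_measure (0 : V) (2 * t k) (r0 k).
  rewrite -EFinM lee_fin /c.
  have ts : t k `^ s = (q `^ s) ^+ k.+1 by rewrite /t exp_powR// ltW.
  have -> : 4 * 4 ^+ n.+1 * w * w ^+ k = 4 * 4 ^+ n.+1 * (t k / t k `^ s) ^+ 2.
    by rewrite -(mulrA _ w) -(exprS w) ts /w /t -expr_div_n -!exprM mulnC.
  rewrite le_eqVlt; apply/orP; left; apply/eqP.
  have t'0 : t k `^ s != 0 by rewrite gt_eqF// powR_gt0.
  rewrite (_ : 2 * (2 * t k) = 4 * t k); last by ring.
  rewrite (exprMn _ 4).
  have tn0 : t k ^+ n.+1 != 0 by rewrite gt_eqF// exprn_gt0.
  by move: (t k ^+ n.+1) tn0 (4 ^+ n.+1 : R) => a a0 b; field; rewrite a0 t'0.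
- by rewrite mulr_ge0 ?sqr_ge0// mulr_ge0// exprn_ge0.
- rewrite sqr_ge0/=.
  have : 0 <= q / q `^ s < 1.
    rewrite divr_ge0 ?powR_ge0 ?(ltW q0)//= ltr_pdivrMr ?powR_gt0// mul1r.
    have q1 : q < 1 by rewrite invf_lt1// ltr1n.
    have qE : q = q `^ s * q `^ (1 - s).
      rewrite -powRD; last by rewrite (gt_eqF q0) implybT.
      by rewrite (addrC s) subrK powRr1// ltW.
    rewrite [ltLHS]qE gtr_pMr ?powR_gt0//.
    by rewrite powR_lt1 ?subr_gt0 ?(ltW q0).
  by move=> /andP[? ?]; rewrite expr_lt1.
Qed.

(** With t = 2^k, the shell t <= |z| < 2t contributes at most 2 * 4^(n+1) * t^(-2s), of ratio
    2^(-2s) < 1 because s > 0. *)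
Lemma frac_const_integral_far_lty s : 0 < s ->
  (\int[lebesgue n.+1]_(z in (~` eball (0%R : V) 1%R : set (lebesgue_rV n.+1)))
     (frac_const_integrand s z)%:E < +oo)%E.
Proof.
move=> s0; pose t k : R := 2 ^+ k.
have t0 k : 0 < t k by exact: exprn_gt0.
have r0 k : 0 <= 2 * t k by rewrite mulr_ge0// ltW.
pose c k := 2 * (t k ^+ n.+1 * (t k `^ s) ^+ 2)^-1.
pose w : R := (2 `^ s) ^- 2.
have mB : measurable (~` eball (0 : V) 1 : set (lebesgue_rV n.+1)).
  by apply: measurableC; exact: measurable_eball.
apply: (@integral_cover_lty R _ (lebesgue_rV n.+1) (lebesgue n.+1) _ _
  (fun k => cube (0 : V) (2 * t k)) c (2 * 4 ^+ n.+1) w).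
- exact: mB.
- apply/measurable_EFinP; apply: measurable_funTS.
  exact: measurable_frac_const_integrand.
- by move=> z _; rewrite lee_fin frac_const_integrand_ge0.
- by move=> k; have [] := cube_measure (0 : V) (2 * t k) (r0 k).
- by move=> k; rewrite mulr_ge0// invr_ge0 mulr_ge0 ?sqr_ge0// exprn_ge0// ltW.
- move=> z; rewrite /eball/= sub0r enormN => /negP; rewrite -leNgt => z1.
  have z0 : 0 < enorm z by exact: lt_le_trans z1.
  (* Inversion carries the exterior of the unit ball to (0, 1], where [dyadic_scale] applies. *)
  have [|k /andP[tz zt]] := @dyadic_scale R (enorm z)^-1.
    by rewrite invr_gt0 z0 invf_le1.
  exists k.
    apply: enorm_cube; rewrite -exprS -lef_pV2 ?posrE ?exprn_gt0//.
    by rewrite -exprVn ltW.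
  rewrite lee_fin; apply: frac_const_integrand_far => //.
  by rewrite t0/= -lef_pV2 ?posrE ?exprn_gt0// -exprVn.
- move=> k; have [_ ->] := cube_measure (0 : V) (2 * t k) (r0 k).
  rewrite -EFinM lee_fin /c.
  have ts : w ^+ k = (t k `^ s) ^- 2.
    by rewrite /w /t exp_powR// exprVn -!exprM mulnC.
  rewrite ts le_eqVlt; apply/orP; left; apply/eqP.
  have t'0 : t k `^ s != 0 by rewrite gt_eqF// powR_gt0.
  rewrite (_ : 2 * (2 * t k) = 4 * t k); last by ring.
  rewrite (exprMn _ 4).
  have tn0 : t k ^+ n.+1 != 0 by rewrite gt_eqF// exprn_gt0.
  by move: (t k ^+ n.+1) tn0 (4 ^+ n.+1 : R) => a a0 b; field; rewrite a0 t'0.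
- by rewrite mulr_ge0// exprn_ge0.
- rewrite invr_ge0 sqr_ge0/= invf_lt1 ?exprn_gt0 ?powR_gt0//.
  rewrite exprn_egt1//.
  by rewrite powR_gt1 ?ltr1n.
Qed.

(* Finiteness matters as much as positivity here: [Rintegral] sends an infinite
   integral to 0, which would make [frac_const] vanish. *)
Lemma frac_const_gt0 (s : R) : 0 < s -> s < 1 -> 0 < frac_const n s.
Proof.
move=> s0 s1; rewrite invr_gt0.
have mB : measurable (eball (0 : V) 1 : set (lebesgue_rV n.+1)).
  exact: measurable_eball.
have mf : measurable_fun [set: lebesgue_rV n.+1]
    (EFin \o (frac_const_integrand s : lebesgue_rV n.+1 -> R)).
  by apply/measurable_EFinP; exact: measurable_frac_const_integrand.
have f0 z : (0 <= (frac_const_integrand s z)%:E)%E.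
  by rewrite lee_fin frac_const_integrand_ge0.
have fin : (\int[lebesgue n.+1]_z (frac_const_integrand s z)%:E < +oo)%E.
  rewrite -(setUv (eball (0 : V) 1)).
  rewrite (ge0_integral_setU _ mB (measurableC mB)).
  - apply: lte_add_pinfty; first exact: frac_const_integral_near0_lty.
    exact: frac_const_integral_far_lty.
  - by rewrite setUv.
  - by move=> z _; exact: f0.
  - by apply/disj_setPS; rewrite setICr.
rewrite lt_neqAle Rintegral_ge0 ?andbT => [|z _]; last first.
  exact: frac_const_integrand_ge0.
apply/eqP => /esym I0.
have : (\int[lebesgue n.+1]_z `|(frac_const_integrand s z)%:E| = 0)%E.
  under eq_integral do rewrite gee0_abs//.
  rewrite -[LHS]fineK ?ge0_fin_numE// ?integral_ge0//.
  by congr EFin.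
move/(ae_eq_integral_abs (lebesgue n.+1) measurableT mf) => ae0.
(* Around (1, ..., 1) the first coordinate stays in (0, 2), inside (0, pi), where cos < 1; so the
   integrand is positive on a ball. *)
pose p : V := const_mx 1.
apply: (@nbhs_not_negligible R _ p (ball p 1)); first exact: nbhsx_ballx.
apply: negligibleS ae0 => z [_ /(_ ord0 ord0)].
rewrite /ball/= mxE ltr_norml => /andP[z1 z2] /(_ I)[].
have z0 : 0 < z ord0 ord0 by move: z2; rewrite ltrBlDr ltrDl.
have z3 : z ord0 ord0 < 2 by move: z1; rewrite ltrBrDr addrC ltrBlDr.
apply/eqP; rewrite gt_eqF// mulr_gt0//; last first.
  by rewrite frac_kernel_gt0// (lt_le_trans _ (ler_coord_enorm _ _ ord0))// gtr0_norm.
rewrite subr_gt0 -[ltRHS]cos0 ltr_cos// in_itv/=.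
  by rewrite lexx pi_ge0.
by rewrite ltW//= (le_trans (ltW z3))// pi_ge2.
Qed.

End frac_const_finite.

(** * Attained minima of lower semicontinuous functions *)

Lemma closure_bounded {R : realType} {V : normedModType R} (A : set V) :
  bounded_set A -> bounded_set (closure A).
Proof.
move=> [M [Mreal AM]]; exists M; split=> // r Mr y.
suff cr : closed [set z : V | `|z| <= r].
  move=> Ay; change ([set z : V | `|z| <= r] y).
  rewrite ((closure_id _).1 cr).
  by apply: closureS Ay => z; exact: AM.
have := @closed_comp V R (fun z : V => `|z|) [set x | x <= r].
by apply; [move=> z _; exact: norm_continuous|exact: closed_le].
Qed.

(* If there were no minimum, compactness along the filter F of the sublevels of u
   would yield a y in K with u y < u x for every x in K, including x = y. *)
Lemma lower_semicontinuous_min {R : realType} {T : topologicalType}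
    (K : set T) (u : T -> R) :
  compact K -> K !=set0 ->
  lower_semicontinuous (fun x : subspace K => (u x)%:E) ->
  exists2 x, K x & forall y, K y -> u x <= u y.
Proof.
move=> /compact_near_coveringP cK [z Kz] lscu; apply: contrapT => nomin.
pose F : set_system T :=
  [set A | exists2 y0, K y0 & forall y, K y -> u y <= u y0 -> A y].
have FF : Filter F.
  split.
  - by exists z.
  - move=> A B [a Ka Aa] [b Kb Bb]; have [ab|ba] := leP (u a) (u b).
      exists a => // y Ky ya.
      by split; [exact: Aa|apply: Bb => //; exact: le_trans ab].
    exists b => // y Ky yb.
    by split; [apply: Aa => //; apply: le_trans (ltW ba)|exact: Bb].
  - by move=> A B AB [a Ka Aa]; exists a => // y Ky /(Aa _ Ky)/AB.
have [|y0 Ky0 /(_ _ Ky0 (lexx _) _ Ky0 Ky0)] :=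
  cK T F (fun y x => K x -> u y < u x) FF.
  move=> x Kx; have [y Ky yx] : exists2 y, K y & u y < u x.
    apply: contrapT => H; apply: nomin; exists x => // y Ky.
    by rewrite leNgt; apply/negP => yx; apply: H; exists y.
  have [W nW Wy] := lscu x (u y) (yx : ((u y)%:E < (u x)%:E)%E).
  have {}nW : nbhs (x : subspace K) W := nW.
  move: nW => /(nbhs_subspace_ex _ Kx)[U nU WU].
  exists (U, [set v | u v <= u y]) => /=.
    by split=> //; exists y.
  move=> [x' v] /= [Ux' vy] Kx'; apply: le_lt_trans vy _.
  have [Wx' _] : (W `&` K) x' by rewrite WU.
  by have := Wy _ Wx'; rewrite lte_fin.
by rewrite ltxx.
Qed.

(** * Rigidity at a global minimum *)

Section superharmonic_minimum.
Context {R : realType} (n : nat).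
Notation V := 'rV[R]_n.+1.

(** The minimum value is left arbitrary, since this serves both at a negative minimum and at a zero
    of u. *)
Lemma superharmonic_min (s : R) (u : V -> R) (x : V) : 0 < s -> s < 1 ->
  frac_laplacian_defined s u x -> 0 <= frac_laplacian s u x ->
  (forall y, u x <= u y) ->
  {ae lebesgue n.+1, forall y, u y = u x}.
Proof.
move=> s0 s1 [intu cvgu] lap_ge0 xmin.
pose E e : set (lebesgue_rV n.+1) := ~` eball x e.
have mE e : measurable (E e) by apply: measurableC; exact: measurable_eball.
(* The sign is flipped to integrate a nonnegative function, whose integral is monotone in the
   domain. *)
pose f y := - frac_integrand s u x y.
have f0 y : 0 <= f y.
  by rewrite oppr_ge0 mulr_le0_ge0 ?subr_le0// frac_kernel_ge0.
pose I e := (\int[lebesgue n.+1]_(y in E e) (f y)%:E)%E.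
have intf e : 0 < e -> (lebesgue n.+1).-integrable (E e) (EFin \o f).
  by move=> /intu /integrableN.
have finI e : 0 < e -> I e \is a fin_num.
  by move=> e0; apply: integrable_fin_num => //; exact: intf.
have truncE e : frac_truncated s u x e = - fine (I e).
  rewrite /frac_truncated /Rintegral -fineN /I -integral_ge0N; last first.
    by move=> y _; rewrite lee_fin.
  congr fine; apply: eq_integral => y _.
  by rewrite -EFinN opprK.
have {lap_ge0} lim_ge0 : 0 <= lim (frac_truncated s u x e @[e --> 0^'+]).
  by move: lap_ge0; rewrite pmulr_rge0// frac_const_gt0.
have I0 (d : R) : 0 < d -> I d = 0%E.
  move=> d0; apply/eqP; rewrite eq_le integral_ge0// ?andbT => [|y _]; last first.
    by rewrite lee_fin.
  (* A truncation at r <= d integrates f over a larger set, so it is at most the truncation at d;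
     hence so is the limit, and 0 <= lim <= - I d. *)
  rewrite -[I d]fineK ?finI// lee_fin -oppr_ge0 -truncE.
  apply: le_trans lim_ge0 _; apply: limr_le => //.
  near=> r.
  have r0 : 0 < r by near: r; exact: nbhs_right_gt.
  rewrite !truncE lerN2 fine_le ?finI//.
  apply: (ge0_subset_integral _ (mE _) (mE _)).
  - by have /integrableP[] := intf _ r0.
  - by move=> y _; rewrite lee_fin.
  - move=> y; rewrite /E /eball/= => /negP; rewrite -leNgt => dy.
    apply/negP; rewrite -leNgt (le_trans _ dy)//.
    by near: r; exact: nbhs_right_le.
(* The countably many radii 1/(k+1) exhaust the complement of x, so the exceptional sets have a null
   union. *)
have ae_out k : {ae lebesgue n.+1, forall y,
    k.+1%:R^-1 <= enorm (x - y) -> u y = u x}.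
  set d : R := k.+1%:R^-1; have d0 : 0 < d by rewrite invr_gt0.
  have /integrableP[mf _] := intf _ d0.
  have : (\int[lebesgue n.+1]_(y in E d) `|(f y)%:E| = 0)%E.
    rewrite -[RHS](I0 _ d0); apply: eq_integral => y _.
    by rewrite gee0_abs// lee_fin.
  move/(ae_eq_integral_abs _ (mE _) mf).
  apply: filterS => y fy dy.
  have /fy[/eqP] : E d y by apply/negP; rewrite -leNgt.
  rewrite oppr_eq0 mulf_eq0 subr_eq0 => /orP[/eqP//|].
  by rewrite gt_eqF// frac_kernel_gt0// (lt_le_trans d0).
have := ae_foralln ae_out; apply: filterS => y uy.
have [xy0|xy0] := eqVneq (enorm (x - y)) 0.
  by have /eqP := enorm_eq0 _ _ xy0; rewrite subr_eq0 => /eqP ->.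
apply: (uy (Num.truncn (enorm (x - y))^-1)).
have xy_gt0 : 0 < enorm (x - y) by rewrite lt_neqAle eq_sym xy0 enorm_ge0.
by rewrite -lef_pV2 ?posrE ?invr_gt0// invrK ltW// truncnS_gt.
Unshelve. all: by end_near. Qed.

Lemma bounded_compl_not_negligible (A : set V) : bounded_set A ->
  ~ (lebesgue n.+1).-negligible (~` A : set (lebesgue_rV n.+1)).
Proof.
(* Points of the unit ball around p have coordinates above M + 1. The bound is read at M + 1 because
   [bounded_set] only bounds by reals strictly above M. *)
move=> [M [_ AM]]; pose p : V := const_mx (M + 2).
apply: (@nbhs_not_negligible R _ p); apply: filterS (nbhsx_ballx p 1 ltr01).
move=> y [_ /(_ ord0 ord0)]; rewrite /ball/= mxE ltr_norml => /andP[_ y1] Ay.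
have := AM (M + 1) _ _ Ay; rewrite ltrDl ltr01 => /(_ isT) yM.
have : `|y ord0 ord0| <= `|y|.
  rewrite [leRHS]/Num.norm/= mx_normrE.
  exact: (le_bigmax _ (fun ij => `|y ij.1 ij.2|) (ord0, ord0)).
move=> /le_trans /(_ yM) /(le_trans (ler_norm _)); rewrite leNgt => /negP; apply.
by move: y1; rewrite ltrBlDr (_ : M + 2 = 1 + (M + 1)) ?ltrD2l//; ring.
Qed.

End superharmonic_minimum.

(** * Weak and strong maximum principles *)

Theorem theorem6p1 (R : realType) (n : nat) (s : R)
    (Omega : set 'rV[R]_n.+1) (u : 'rV[R]_n.+1 -> R)
    (s_gt0 : 0 < s) (s_lt1 : s < 1)
    (domOmega : bounded_domain Omega)
    (lsc_u : lsc_within (closure Omega) u)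
    (def_u : forall x, Omega x -> frac_laplacian_defined s u x)
    (superharm_u : forall x, Omega x -> 0 <= frac_laplacian s u x)
    (u_ge0 : forall x, ~ Omega x -> 0 <= u x) :
  (forall x, Omega x -> 0 <= u x) /\
  ((forall x, Omega x -> 0 < u x) \/
   [/\ {ae lebesgue n.+1, forall x, u x = 0},
       (forall x, Omega x -> u x = 0)
     & (forall x, {for x, continuous u} -> u x = 0)]).
Proof.
have [openO _ [z Oz] bndO] := domOmega.
have cO : compact (closure Omega).
  by apply: bounded_closed_compact; [exact: closure_bounded|exact: closed_closure].
have [m _ mmin] :=
  lower_semicontinuous_min _ _ cO (ex_intro _ z (subset_closure Oz)) lsc_u.
have minO (x : 'rV[R]_n.+1) : Omega x -> (forall y, u x <= u y) ->
    {ae lebesgue n.+1, forall y, u y = u x}.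
  by move=> Ox; apply: superharmonic_min; [| |exact: def_u|exact: superharm_u].
have um : 0 <= u m.
  rewrite leNgt; apply/negP => um.
  (* A minimum on the boundary is excluded: such a point is outside the open set [Omega], where u >=
     0. *)
  have mO : Omega m by apply: contrapT => /u_ge0; rewrite leNgt um.
  have /(minO _ mO) aem : forall y, u m <= u y.
    move=> y; have [Oy|/u_ge0 uy] := pselect (Omega y).
      exact/mmin/subset_closure.
    exact: le_trans (ltW um) uy.
  apply: (bounded_compl_not_negligible _ _ bndO).
  apply: negligibleS aem => y /= /u_ge0 uy uym.
  by rewrite uym leNgt um in uy.
have u0 y : 0 <= u y.
  have [Oy|/u_ge0//] := pselect (Omega y).
  exact/(le_trans um)/mmin/subset_closure.
split=> [x _ //|].
have [|npos] := pselect (forall x, Omega x -> 0 < u x); [by left|right].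
have [x Ox ux] : exists2 x, Omega x & u x = 0.
  apply: contrapT => H; apply: npos => x Ox; rewrite lt_neqAle u0 andbT eq_sym.
  by apply/eqP => ux; apply: H; exists x.
have ae0 : {ae lebesgue n.+1, forall y, u y = 0}.
  by rewrite -ux; apply: minO => // y; rewrite ux.
(* The two pointwise claims differ only in why positivity spreads: lower semicontinuity inside
   [Omega], continuity at y otherwise. *)
have zero_of (y : 'rV[R]_n.+1) : (0 < u y -> \forall t \near y, 0 < u t) -> u y = 0.
  move=> pos; apply/eqP; rewrite eq_le u0 andbT leNgt; apply/negP => /pos.
  exact: ae0_nbhs ae0.
split=> // y.
  move=> Oy; apply: zero_of => uy.
  have [W nW Wy] := lsc_u y 0 (uy : (0%:E < (u y)%:E)%E).
  (* W is a neighbourhood only relative to the closure of [Omega]; intersecting with the open set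
     [Omega] gives one in the whole space. *)
  have {}nW : nbhs (y : subspace (closure Omega)) W := nW.
  move: nW => /(nbhs_subspace_ex _ (subset_closure Oy))[U nU WU].
  have nO : nbhs y Omega by exact: open_nbhs_nbhs.
  apply: filterS2 nU nO => t Ut Ot; have [Wt _] : (W `&` closure Omega) t.
    by rewrite WU; split=> //; exact: subset_closure.
  by have := Wy _ Wt; rewrite lte_fin.
move=> cu; apply: zero_of => uy.
exact: (cvgr_gt _ cu _ uy).
Qed.
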